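(* Every convex quadrangle is $n$-self-affine for every integer $n \ge 5$.
   Context: A convex quadrangle $D$ is $n$-self-affine if there are closed sets $D_1,\dots,D_n$ with $D=\bigcup_i D_i$, pairwise disjoint interiors, and each $D_i$ an image of $D$ under an invertible affine map of the plane. *)

(* Defs.v *)
From HB Require Import structures.
From mathcomp Require Import all_boot all_order all_algebra.
From mathcomp Require Import all_classical all_reals all_analysis.

Set Implicit Arguments.
Unset Strict Implicit.
Unset Printing Implicit Defensive.

Import Order.TTheory GRing.Theory Num.Theory.
Import numFieldNormedType.Exports.

Local Open Scope classical_set_scope.
Local Open Scope ring_scope.

Definition convex_hull (R : realType) (A : set 'rV[R]_2) : set 'rV[R]_2 :=
  smallest (fun C : set 'rV[R]_2 => convex_set C) A.

(* The closed region spanned by four points in convex position.  A collinear or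
   repeated triple among the points would put one of them in the hull of the
   others, so the vertices are distinct and the region is non-degenerate. *)
Definition convex_quadrangle (R : realType) (D : set 'rV[R]_2) : Prop :=
  exists v : 'I_4 -> 'rV[R]_2,
    (forall i, ~ convex_hull (v @` [set j | j != i]) (v i)) /\
    D = convex_hull (range v).

Definition invertible_affine (R : realType) (f : 'rV[R]_2 -> 'rV[R]_2) : Prop :=
  exists (A : 'M[R]_2) (b : 'rV[R]_2),
    A \in unitmx /\ forall x, f x = x *m A + b.

Definition self_affine (R : realType) (n : nat) (D : set 'rV[R]_2) : Prop :=
  exists D_ : 'I_n -> set 'rV[R]_2,
    [/\ forall i, closed (D_ i),
        D = \bigcup_i D_ i,
        trivIset setT (fun i => interior (D_ i))
      & forall i, exists2 f, invertible_affine f & D_ i = f @` D].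

(* Main.v *)
(** Two copies of a quadrangle [Q] with a pair of non-parallel opposite sides,
    one of them reflected so that the two side lines are exchanged, can be put
    one behind the other between those lines and form a trapezoid. A trapezoid
    can be sliced into any number of affine copies of itself, so this trapezoid
    is dissected into [2 k] copies of [Q] for every [k >= 1].

    Odd [n >= 5]: remove from [Q] a homothetic copy with centre a vertex [C];
    the rest is cut, along the ray from [C] to the opposite vertex [A], into two
    trapezoids, whose common ratio is the homothety ratio and is thus free.

    Even [n >= 6]: put a homothetic copy at [C] and, at [A], a copy with its
    [C]-vertex at [A], meeting the first one at a point [P] of the diagonal
    [AC]. What remains is again two trapezoids of the same ratio; moving [P]
    gives them any ratio on one side of [1], provided that [AC] is not bisected
    by the other diagonal. If it is, use the other diagonal: both are bisected
    only in a parallelogram.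

    Trapezoids and parallelograms are simply sliced. *)
Require Import Defs.
From mathcomp Require Import all_boot all_order all_algebra.
From mathcomp Require Import all_classical all_reals all_analysis.
From mathcomp Require Import ring lra zify.

Set Implicit Arguments.
Unset Strict Implicit.
Unset Printing Implicit Defensive.

Import Order.TTheory GRing.Theory Num.Theory.
Import numFieldNormedType.Exports.

Local Open Scope classical_set_scope.
Local Open Scope ring_scope.

(** * Affine maps, separation and tilings *)

Section AffineMaps.
Variable R : realType.
Implicit Types (f g : 'rV[R]_2 -> 'rV[R]_2) (D X Y Z : set 'rV[R]_2).

Definition aff (p q r p' q' r' : R) (z : 'rV[R]_2) : 'rV[R]_2 :=
  \row_j if j == 0 then p * z 0 0 + q * z 0 1 + r
         else p' * z 0 0 + q' * z 0 1 + r'.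

Lemma aff0 p q r p' q' r' z :
  aff p q r p' q' r' z 0 0 = p * z 0 0 + q * z 0 1 + r.
Proof. by rewrite mxE. Qed.

Lemma aff1 p q r p' q' r' z :
  aff p q r p' q' r' z 0 1 = p' * z 0 0 + q' * z 0 1 + r'.
Proof. by rewrite mxE. Qed.

Definition affE := (aff0, aff1).

Lemma sum_ord2 (V : nmodType) (F : 'I_2 -> V) : \sum_i F i = F 0 + F 1.
Proof.
rewrite big_ord_recl big_ord1; congr (_ + F _).
exact: val_inj.
Qed.

Lemma row2P (z z' : 'rV[R]_2) : z 0 0 = z' 0 0 -> z 0 1 = z' 0 1 -> z = z'.
Proof.
move=> e0 e1; apply/rowP => j.
have [->//|j0] := eqVneq j 0; suff -> : j = 1 by [].
by apply: val_inj; case: j j0 => [[|[|]]].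
Qed.

Lemma aff_invertible p q r p' q' r' :
  p * q' - q * p' != 0 -> invertible_affine (aff p q r p' q' r').
Proof.
move=> d0.
(* Row vectors are multiplied on the right, so [A] is the transposed coefficient matrix; [B] is its
   adjugate divided by the determinant. *)
pose A : 'M[R]_2 := \matrix_(i, j)
  if i == 0 then if j == 0 then p else p' else if j == 0 then q else q'.
pose B : 'M[R]_2 := \matrix_(i, j) ((p * q' - q * p')^-1 *
  if i == 0 then if j == 0 then q' else - p' else if j == 0 then - q else p).
exists A, (\row_j if j == 0 then r else r'); split => [|z].
  suff : A *m B = 1%:M by case/mulmx1_unit.
  apply/matrixP => i j; rewrite !mxE sum_ord2 !mxE /=.
  case: i j => [[|[|]]] // ? [[|[|]]] // ?;
  by rewrite -!val_eqE /=; field.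
by apply: row2P; rewrite !mxE sum_ord2 !mxE /=; ring.
Qed.

Lemma invertible_affine_comp f g :
  invertible_affine f -> invertible_affine g -> invertible_affine (f \o g).
Proof.
move=> [A [b [uA fE]]] [B [c [uB gE]]].
exists (B *m A), (c *m A + b); split=> [|x]; first by rewrite unitmx_mul uA uB.
by rewrite /= fE gE mulmxDl mulmxA addrA.
Qed.

Lemma invertible_affine_inv f : invertible_affine f ->
  exists g, [/\ invertible_affine g, cancel f g & cancel g f].
Proof.
move=> [A [b [uA fE]]].
exists (fun x => x *m invmx A - b *m invmx A); split.
- by exists (invmx A), (- (b *m invmx A)); rewrite unitmx_inv.
- by move=> x; rewrite fE mulmxDl mulmxK// addrK.
- by move=> x; rewrite fE mulmxBl !mulmxKV// subrK.
Qed.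

Lemma closed_half_plane (p q r : R) :
  closed [set z : 'rV[R]_2 | 0 <= p * z 0 0 + q * z 0 1 + r].
Proof.
have cont (c : R) i : continuous (fun z : 'rV[R]_2 => c * z 0 i).
  by move=> z; exact: (cvgMl_tmp (@coord_continuous R 1 2 0 i z)).
apply: (@preimage_closed _ _ (((fun z : 'rV[R]_2 => p * z 0 0) +
  (fun z => q * z 0 1)) + cst r) [set x | 0 <= x]); last exact: closed_ge.
move=> z _; apply: continuousD; last exact: cst_continuous.
by apply: continuousD; exact: cont.
Qed.

(** Weak separation by a line stands in for disjoint interiors: it implies it, passes to subsets,
    pulls back along affine maps, and is checked by linear arithmetic. *)
Definition separated Y Z := exists (a : 'cV[R]_2) (c : R), [/\ a != 0,
  forall z, Y z -> 0 <= (z *m a) 0 0 + c &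
  forall z, Z z -> (z *m a) 0 0 + c <= 0].

Lemma separated_intro (p q r : R) Y Z : (p != 0) || (q != 0) ->
  (forall z, Y z -> 0 <= p * z 0 0 + q * z 0 1 + r) ->
  (forall z, Z z -> p * z 0 0 + q * z 0 1 + r <= 0) -> separated Y Z.
Proof.
move=> pq Y0 Z0; exists (\col_i if i == 0 then p else q), r.
have E (z : 'rV[R]_2) : (z *m \col_i (if i == 0 then p else q)) 0 0 + r =
    p * z 0 0 + q * z 0 1 + r.
  by rewrite mxE sum_ord2 !mxE /= mulrC (mulrC q).
split=> [|z|z]; [|by rewrite E; exact: Y0|by rewrite E; exact: Z0].
apply: contraTneq pq => /colP e; have := e 0; have := e 1.
by rewrite !mxE /= => -> ->; rewrite eqxx.
Qed.

Lemma separated_sym Y Z : separated Y Z -> separated Z Y.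
Proof.
move=> [a [c [a0 Y0 Z0]]]; exists (- a), (- c); rewrite oppr_eq0.
have E (z : 'rV[R]_2) : (z *m - a) 0 0 - c = - ((z *m a) 0 0 + c).
  by rewrite mulmxN opprD [in LHS]mxE.
split => // z; rewrite E; first by rewrite oppr_ge0; exact: Z0.
by rewrite oppr_le0; exact: Y0.
Qed.

Lemma separatedS Y Y' Z : Y' `<=` Y -> separated Z Y -> separated Z Y'.
Proof.
by move=> YY [a [c [a0 Z0 Y0]]]; exists a, c; split => // z /YY; exact: Y0.
Qed.

(** The pulled-back line has normal [A *m a], which is nonzero because [A] is invertible. *)
Lemma separated_preimage f Y Z : invertible_affine f ->
  separated Y Z -> separated (f @^-1` Y) (f @^-1` Z).
Proof.
move=> [A [b [uA fE]]] [a [c [a0 Y0 Z0]]].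
exists (A *m a), ((b *m a) 0 0 + c).
have E z : (z *m (A *m a)) 0 0 + ((b *m a) 0 0 + c) = (f z *m a) 0 0 + c.
  by rewrite addrA fE mulmxDl mulmxA [in RHS]mxE.
split=> [|z /Y0|z /Z0]; rewrite ?E//.
by apply: contraNneq a0 => Aa0; rewrite -(mulKmx uA a) Aa0 mulmx0.
Qed.

(* If z is interior to Z and lies in Y, moving z slightly along the normal of
   the separating line stays in Z but crosses to the side of Y. *)
Lemma separated_interior Y Z : separated Y Z ->
  interior Y `&` interior Z = set0.
Proof.
move=> [a [c [a0 Y0 Z0]]]; apply/seteqP; split => // z [/interior_subset Yz Zz].
pose g (d : R) := z + d *: a^T.
have cg : g d @[d --> 0^'+] --> z.
  rewrite -[X in _ --> X]addr0 -(scale0r a^T).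
  apply: (@cvgD _ _ _ _ _ (cst z) (fun d => d *: a^T)); first exact: cvg_cst.
  by apply: cvgZr_tmp; exact: cvg_at_right_filter.
have : \forall d \near 0^'+, Z (g d) by exact: cg.
have pos : \forall d \near 0^'+, (0 : R) < d by exact: nbhs_right_gt.
move=> /(filterI pos) /filter_ex [d [d0 /Z0]].
(* Along the normal the form grows by [d] times the squared length of [a]. *)
have -> : (g d *m a) 0 0 + c = (z *m a) 0 0 + c + d * (a^T *m a) 0 0.
  rewrite [RHS]addrAC /g mulmxDl -scalemxAl; congr (_ + c).
  by rewrite [LHS]mxE; congr (_ + _); rewrite [LHS]mxE.
rewrite leNgt => /negP; apply; rewrite ltr_wpDl ?Y0// mulr_gt0// mxE lt0r.
have [i ai] : exists i, a i 0 != 0.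
  apply/existsP; apply: contraNT a0 => /existsPn a0; apply/eqP/colP => i.
  by rewrite mxE; have /negPn/eqP := a0 i.
have sq j : 0 <= a^T 0 j * a j 0 by rewrite mxE -expr2 sqr_ge0.
rewrite sumr_ge0 ?andbT// psumr_neq0//; apply/hasP; exists i.
  exact: mem_index_enum.
by rewrite /= mxE lt0r -expr2 sqr_ge0 sqrf_eq0 ai.
Qed.

(** Copies are preimages rather than images, so that membership unfolds to inequalities on [f z]
    without a witness. *)
Definition affine_copy D Y := exists2 f, invertible_affine f & Y = f @^-1` D.

Definition tiled D n X := exists l : seq (set 'rV[R]_2), [/\ size l = n,
  X = \big[setU/set0]_(Y <- l) Y,
  all (fun Y => `[< affine_copy D Y >]) l &
  pairwise (fun Y Z => `[< separated Y Z >]) l].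

Lemma affine_copy_tiled D X : affine_copy D X -> tiled D 1 X.
Proof.
move=> DX; exists [:: X]; split => //=; first by rewrite big_seq1.
by rewrite andbT; apply/asboolP.
Qed.

Lemma tiled_preimage D n X f : invertible_affine f ->
  tiled D n X -> tiled D n (f @^-1` X).
Proof.
move=> invf [l [sl -> Dl seql]]; exists [seq f @^-1` Y | Y <- l]; split.
- by rewrite size_map.
- rewrite big_map; elim/big_ind2 : _ => //.
  by move=> ? ? ? ? <- <-.
- rewrite all_map; apply: sub_all Dl => Y /asboolP [g invg ->] /=.
  by apply/asboolP; exists (g \o f) => //; exact: invertible_affine_comp.
- rewrite pairwise_map; apply: sub_pairwise seql => Y Z /asboolP YZ.
  by apply/asboolP; exact: separated_preimage.
Qed.

Lemma tiled_base D D' n X : affine_copy D D' -> tiled D' n X -> tiled D n X.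
Proof.
move=> [f invf ->] [l [sl -> Dl sepl]]; exists l; split => //.
apply: sub_all Dl => Y /asboolP [g invg ->]; apply/asboolP.
by exists (f \o g) => //; exact: invertible_affine_comp.
Qed.

Lemma bigcup_seqP (l : seq (set 'rV[R]_2)) z :
  (\big[setU/set0]_(Y <- l) Y) z <-> exists2 i, (i < size l)%N & nth set0 l i z.
Proof.
elim: l => [|Y l IHl]; first by rewrite big_nil; split => // -[].
rewrite big_cons; split=> [[Yz|/IHl[i il liz]]|[[|i] /= il liz]].
- by exists 0%N.
- by exists i.+1.
- by left.
- by right; apply/IHl; exists i.
Qed.

Lemma tiled_cover D X (s : seq (nat * set 'rV[R]_2)) :
  X = \big[setU/set0]_(p <- s) p.2 ->
  all (fun p => `[< tiled D p.1 p.2 >]) s ->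
  pairwise (fun p q => `[< separated p.2 q.2 >]) s ->
  tiled D (sumn (unzip1 s)) X.
Proof.
move=> -> Ds seps.
(* The last clause strengthens the induction: it separates the tiles of the first region from those
   of all later regions. *)
suff [l [? ? ? ? _]] : exists l : seq (set 'rV[R]_2),
    [/\ size l = sumn (unzip1 s),
      \big[setU/set0]_(p <- s) p.2 = \big[setU/set0]_(Y <- l) Y,
      all (fun Y => `[< affine_copy D Y >]) l,
      pairwise (fun Y Z => `[< separated Y Z >]) l &
      forall Z, all (fun p => `[< separated Z p.2 >]) s ->
        all (fun Y => `[< separated Z Y >]) l] by exists l.
have sub (l : seq (set 'rV[R]_2)) Z :
    separated Z (\big[setU/set0]_(Y <- l) Y) ->
    all (fun Y => `[< separated Z Y >]) l.
  move=> sepZ; apply/(all_nthP set0) => i il; apply/asboolP.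
  by apply: separatedS sepZ => z liz; apply/bigcup_seqP; exists i.
elim: s Ds seps => [|[n Y] s IHs] /=; first by exists [::]; rewrite !big_nil.
move=> /andP[/asboolP[l1 [s1 Y1 D1 sep1]] Ds] /andP[sepY seps].
have [l [sl sE Dl sepl sepZ]] := IHs Ds seps.
exists (l1 ++ l); split.
- by rewrite size_cat s1 sl.
- by rewrite big_cons big_cat /= -sE -Y1.
- by rewrite all_cat D1.
- rewrite pairwise_cat sep1 sepl !andbT; apply/(all_nthP set0) => i il1.
  apply: sepZ; apply: sub_all sepY => p /asboolP Yp; apply/asboolP.
  apply: separated_sym; apply: separatedS (separated_sym Yp) => z.
  by move=> l1z; rewrite Y1; apply/bigcup_seqP; exists i.
- move=> Z /andP[/asboolP ZY Zs]; rewrite all_cat sepZ// andbT.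
  by apply: sub; rewrite -Y1.
Qed.

(** A preimage under [f] is the image under the inverse of [f], and separated tiles have disjoint
    interiors. *)
Lemma tiled_self_affine D n : (forall Y, affine_copy D Y -> closed Y) ->
  tiled D n D -> self_affine n D.
Proof.
move=> cD [l [sl DE Dl sepl]].
have lt_l (i : 'I_n) : (i < size l)%N by rewrite sl.
have copy (i : 'I_n) : affine_copy D (nth set0 l i).
  by have /(all_nthP set0)/(_ _ (lt_l i))/asboolP := Dl.
exists (fun i => nth set0 l i); split.
- by move=> i; exact: cD.
- rewrite [LHS]DE; apply/seteqP; split=> z; rewrite bigcup_seqP.
    by rewrite sl => -[i il liz]; exists (Ordinal il).
  by move=> [i _ liz]; exists i.
- move=> i j _ _; case: (ltngtP i j) => [ij|ji|/val_inj//].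
    have /(pairwiseP set0)/(_ i j (lt_l i) (lt_l j) ij)/asboolP := sepl.
    by move=> /separated_interior ->; case.
  have /(pairwiseP set0)/(_ j i (lt_l j) (lt_l i) ji)/asboolP := sepl.
  by move=> /separated_interior; rewrite setIC => ->; case.
- move=> i; have [f invf ->] := copy i.
  have [g [invg fK gK]] := invertible_affine_inv invf.
  exists g => //; apply/seteqP; split=> z /=; first by exists (f z).
  by move=> [y Dy <-]; rewrite gK.
Qed.

End AffineMaps.

(** * Quadrangles in normal form and trapezoids *)

Section Quadrangles.
Variable R : realType.
Implicit Types (m n w : R) (D X Y Z : set 'rV[R]_2).

(* The quadrangle with vertices C = (0, 0), B = (1, 0), A = (a, b), E = (0, 1)
   is [quad m n] for m = (1 - a) / b and n = (1 - b) / a; the conditions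
   a, b > 0 and a + b > 1 read m < 1, n < 1 and m * n < 1. *)
Definition quad m n : set 'rV[R]_2 := [set z | [/\ 0 <= z 0 0, 0 <= z 0 1,
  z 0 0 + m * z 0 1 <= 1 & n * z 0 0 + z 0 1 <= 1]].

(* The parallel sides are [0, 1] x {0} and [0, w] x {1}. *)
Definition trapezoid w := quad (1 - w) 0.

Lemma closed_quad_preimage m n f :
  invertible_affine f -> closed (f @^-1` quad m n).
Proof.
move=> [A [b [_ fE]]].
have half (p q r : R) : closed [set z | 0 <= p * f z 0 0 + q * f z 0 1 + r].
  have E z : p * f z 0 0 + q * f z 0 1 + r =
      (p * A 0 0 + q * A 0 1) * z 0 0 + (p * A 1 0 + q * A 1 1) * z 0 1 +
      (p * b 0 0 + q * b 0 1 + r).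
    by rewrite fE mxE (mxE _ _ 0 1) ![(_ *m _) _ _]mxE !sum_ord2; ring.
  under eq_set do rewrite E; exact: closed_half_plane.
have -> : f @^-1` quad m n = ([set z | 0 <= 1 * f z 0 0 + 0 * f z 0 1 + 0] `&`
    [set z | 0 <= 0 * f z 0 0 + 1 * f z 0 1 + 0]) `&`
   ([set z | 0 <= -1 * f z 0 0 + - m * f z 0 1 + 1] `&`
    [set z | 0 <= - n * f z 0 0 + -1 * f z 0 1 + 1]).
  apply/seteqP; split=> z; rewrite /quad /=.
    by move=> [? ? ? ?]; split; split; lra.
  by move=> [[? ?] [? ?]]; split; lra.
by do 2?apply: closedI; exact: half.
Qed.

(** The line through the midpoints of the parallel sides leaves two trapezoids with the same ratio
    of parallel sides, hence affine copies of the whole. *)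
Lemma trapezoid_slices D p q w : tiled D p (trapezoid w) ->
  tiled D q (trapezoid w) -> tiled D (p + q) (trapezoid w).
Proof.
move=> Dp Dq.
have d0 : (2 : R) * 1 - 0 * 0 != 0 by apply/eqP; lra.
have d1 : (2 : R) * 1 - (1 - w) * 0 != 0 by apply/eqP; lra.
pose Y := aff 2 0 0 0 1 0 @^-1` trapezoid w.
pose Z := aff 2 (1 - w) (-1) 0 1 0 @^-1` trapezoid w.
rewrite -[q]addn0; apply: (@tiled_cover _ _ _ [:: (p, Y); (q, Z)]).
- rewrite !big_cons big_nil setU0; apply/seteqP; split=> z;
    rewrite /Y /Z /trapezoid /quad /= !affE.
    move=> [? ? ? ?]; have [?|?] := leP (2 * z 0 0 + (1 - w) * z 0 1) 1.
      by left; split; lra.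
    by right; split; lra.
  by case=> -[? ? ? ?]; split; lra.
- rewrite /= andbT; apply/andP; split; apply/asboolP.
    exact: (tiled_preimage (aff_invertible _ _ d0)).
  exact: (tiled_preimage (aff_invertible _ _ d1)).
- rewrite /= !andbT; apply/asboolP.
  apply: (@separated_intro _ (-2) (- (1 - w)) 1).
  + by apply/orP; left; apply/eqP; lra.
  + by move=> z; rewrite /Y /trapezoid /quad /= !affE => -[? ? ? ?]; lra.
  + by move=> z; rewrite /Z /trapezoid /quad /= !affE => -[? ? ? ?]; lra.
Qed.

Lemma tiled_trapezoid D k j w : tiled D k (trapezoid w) ->
  tiled D (k * j.+1) (trapezoid w).
Proof.
move=> Dk; elim: j => [|j IHj]; first by rewrite muln1.
by rewrite mulnS; exact: trapezoid_slices.
Qed.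

(** Turning the trapezoid upside down exchanges its parallel sides; rescaling the new base to length
    1 inverts the ratio. *)
Lemma trapezoid_flip D k w : 0 < w -> tiled D k (trapezoid w) ->
  tiled D k (trapezoid w^-1).
Proof.
move=> w0 Dk; have d0 : w * -1 - 0 * 0 != 0 by apply/eqP; lra.
have -> : trapezoid w^-1 = aff w 0 0 0 (-1) 1 @^-1` trapezoid w.
  have E z : w * z 0 0 + 0 * z 0 1 + 0 + (1 - w) * (0 * z 0 0 + -1 * z 0 1 + 1)
      = w * (z 0 0 + (1 - w^-1) * z 0 1 - 1) + 1 :> R.
    by field; rewrite gt_eqF.
  apply/seteqP; split=> z; rewrite /trapezoid /quad /= !affE E gerDr.
    move=> [? ? ? ?]; split; [|lra|rewrite pmulr_rle0//|]; try lra.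
    by rewrite mul0r !addr0 mulr_ge0// ltW.
  rewrite mul0r !addr0 pmulr_rge0// pmulr_rle0// => -[? ? ? ?].
  by split; lra.
by apply: tiled_preimage => //; exact: aff_invertible.
Qed.

End Quadrangles.

(** * Dissections of a quadrangle *)

Section Dissections.
Variable R : realType.
Implicit Types m n w : R.

Lemma aff_copy_quad m n (p q r p' q' r' : R) : p * q' - q * p' != 0 ->
  tiled (quad m n) 1 (aff p q r p' q' r' @^-1` quad m n).
Proof.
move=> d0; apply: affine_copy_tiled.
by exists (aff p q r p' q' r') => //; exact: aff_invertible.
Qed.

Lemma tiled_aff D k X p q r p' q' r' : p * q' - q * p' != 0 ->
  tiled D k X -> tiled D k (@aff R p q r p' q' r' @^-1` X).
Proof. by move=> d0; apply: tiled_preimage; exact: aff_invertible. Qed.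

Lemma quad_pair m n : m < 1 -> n < 1 -> m * n < 1 ->
  tiled (quad m n) 2 (trapezoid ((1 - m) ^+ 2 / (1 - m * n))).
Proof.
move=> m1 n1 mn1.
(* Between the lines x = 0 and x + m * y = 1, the quadrangle followed by its
   reflected copy reaches up to y = h; Y and Z are the two, scaled to h = 1. *)
pose c : R := (1 - m)^-1; pose h : R := (2 - m - n) / (1 - m * n).
have c0 : 0 < c by rewrite invr_gt0 subr_gt0.
have h0 : 0 < h by apply: divr_gt0; lra.
pose Y := aff 1 0 0 0 h 0 @^-1` quad m n.
(* The second copy is glued by its side [CB] along the side [EA] of the first, its [C] at [A] and
   its [B] at [E]. *)
pose Z := aff (- c) (- c * m * h) c (c * n) (c * h) (- c) @^-1` quad m n.
have YE z : Y z <-> [/\ 0 <= z 0 0, 0 <= h * z 0 1,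
    z 0 0 + m * (h * z 0 1) <= 1 & n * z 0 0 + h * z 0 1 <= 1].
  by rewrite /Y /quad /= !affE; split=> -[? ? ? ?]; split; lra.
have ZE z : Z z <-> [/\ 0 <= 1 - z 0 0 - m * (h * z 0 1),
    0 <= n * z 0 0 + h * z 0 1 - 1, 0 <= z 0 0
    & 0 <= h - h * z 0 1].
  rewrite /Z /quad /= !affE.
  set x := z 0 0; set y := z 0 1.
  have -> : - c * x + - c * m * h * y + c = c * (1 - x - m * (h * y)) by ring.
  have -> : c * n * x + c * h * y - c = c * (n * x + h * y - 1) by ring.
  rewrite !pmulr_rge0// -[in X in [/\ _, _, X & _]]subr_ge0.
  rewrite -[in X in [/\ _, _, _ & X]]subr_ge0.
  have -> : 1 - (c * (1 - x - m * (h * y)) + m * (c * (n * x + h * y - 1))) =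
      c * ((1 - m * n) * x).
    by rewrite /c; field; rewrite subr_eq0 gt_eqF.
  have -> : 1 - (n * (c * (1 - x - m * (h * y))) + c * (n * x + h * y - 1)) =
      c * ((1 - m * n) * (h - h * y)).
    by rewrite /c /h; field; rewrite !subr_eq0 ?gt_eqF.
  by rewrite !pmulr_rge0// subr_gt0.
have TE z : trapezoid ((1 - m) ^+ 2 / (1 - m * n)) z <-> [/\ 0 <= z 0 0,
    0 <= h * z 0 1, z 0 0 + m * (h * z 0 1) <= 1 & 0 <= h - h * z 0 1].
  rewrite /trapezoid /quad /= mul0r add0r pmulr_rge0//.
  have -> : h - h * z 0 1 = h * (1 - z 0 1) by ring.
  rewrite pmulr_rge0// subr_ge0.
  (* The strip has width 1 at height 0 and [1 - m * h] at height [h]; the latter is the ratio. *)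
  have -> // : (1 - (1 - m) ^+ 2 / (1 - m * n)) * z 0 1 = m * (h * z 0 1).
  by rewrite /h; field; rewrite subr_eq0 gt_eqF.
have hE : (1 - m * n) * h = 2 - m - n.
  by rewrite /h mulrC divfK// subr_eq0 gt_eqF.
apply: (@tiled_cover _ _ _ [:: (1%N, Y); (1%N, Z)]).
- rewrite !big_cons big_nil setU0; apply/seteqP; split=> z;
    rewrite /setU /mkset /=.
    rewrite YE ZE TE => -[? ? ? ?].
    have [?|?] := leP (n * z 0 0 + h * z 0 1) 1; first by left; split.
    by right; split => //; lra.
  rewrite YE ZE TE; set x := z 0 0; set y := h * z 0 1.
  case=> [[x0 y0 mxy nxy]|[mxy nxy x0 hy]]; split=> //.
  (* The highest vertex of the first copy is [E] for [0 <= n] and [A] for [n < 0]. *)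
  + suff : 0 <= (1 - m * n) * (h - y) by rewrite pmulr_rge0// subr_gt0.
    rewrite mulrBr hE; have [n0|n0] := leP 0 n; [nra|].
    have : 0 <= - n * (1 - (x + m * y)) by apply: mulr_ge0; lra.
    by nra.
  + suff : 0 <= (1 - m * n) * y by rewrite pmulr_rge0// subr_gt0.
    have [n0|n0] := leP 0 n; last by apply: mulr_ge0; nra.
    have : 0 <= n * (1 - x - m * y) by exact: mulr_ge0.
    by nra.
  + by lra.
- rewrite /= !andbT; apply/andP; split; apply/asboolP; apply: aff_copy_quad.
    by apply/eqP; lra.
  have -> : - c * (c * h) - - c * m * h * (c * n) = - (c * c * h * (1 - m * n)).
    by ring.
  have mn0 : 0 < 1 - m * n by rewrite subr_gt0.
  by rewrite oppr_eq0 gt_eqF// (mulr_gt0 (mulr_gt0 (mulr_gt0 c0 c0) h0)).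
- rewrite /= !andbT; apply/asboolP; apply: (@separated_intro _ (- n) (- h) 1).
  + by rewrite !oppr_eq0 (gt_eqF h0) orbT.
  + by move=> z /YE[? ? ? ?]; lra.
  + by move=> z /ZE[? ? ? ?]; lra.
Qed.

(** [K] is the homothetic copy with centre [C] and ratio [w]. Each half of the rest, cut along the
    diagonal [CA], lies between a side at [A] and its homothetic image, so its parallel sides have
    ratio [w]. *)
Lemma tiled_odd m n w p q : m < 1 -> n < 1 -> m * n < 1 ->
  0 < w < 1 -> tiled (quad m n) p (trapezoid w) ->
  tiled (quad m n) q (trapezoid w) ->
  tiled (quad m n) (1 + p + q) (quad m n).
Proof.
move=> m1 n1 mn1 /andP[w0 w1] Dp Dq.
pose c : R := (1 - n)^-1; pose d : R := (1 - m)^-1.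
pose e : R := (1 - w)^-1; pose k : R := w^-1.
have c0 : 0 < c by rewrite invr_gt0 subr_gt0.
have d0 : 0 < d by rewrite invr_gt0 subr_gt0.
have e0 : 0 < e by rewrite invr_gt0 subr_gt0.
have k0 : 0 < k by rewrite invr_gt0.
have mn0 : 0 < 1 - m * n by rewrite subr_gt0.
pose K := aff k 0 0 0 k 0 @^-1` quad m n.
(* The first coordinate vanishes on the diagonal [CA], the second on the side [BA]: the vertices [A]
   and [B] become the ends of the base. The piece [E] is symmetric. *)
pose B := aff (c * (1 - n)) (- c * (1 - m)) 0 (- e) (- e * m) e
  @^-1` trapezoid w.
pose E := aff (- d * (1 - n)) (d * (1 - m)) 0 (- e * n) (- e) e
  @^-1` trapezoid w.
have KE z : K z <-> [/\ 0 <= z 0 0, 0 <= z 0 1, z 0 0 + m * z 0 1 <= w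
    & n * z 0 0 + z 0 1 <= w].
  rewrite /K /quad /= !affE !mul0r !addr0 add0r !pmulr_rge0//.
  have -> : k * z 0 0 + m * (k * z 0 1) = k * (z 0 0 + m * z 0 1) by ring.
  have -> : n * (k * z 0 0) + k * z 0 1 = k * (n * z 0 0 + z 0 1) by ring.
  by rewrite !ler_pdivrMl// mulr1.
have BE z : B z <-> [/\ (1 - m) * z 0 1 <= (1 - n) * z 0 0,
    0 <= 1 - z 0 0 - m * z 0 1, 0 <= z 0 1 & 1 - z 0 0 - m * z 0 1 <= 1 - w].
  rewrite /B /trapezoid /quad /= !affE mul0r add0r.
  set x := z 0 0; set y := z 0 1.
  have -> : c * (1 - n) * x + - c * (1 - m) * y + 0 =
    c * ((1 - n) * x - (1 - m) * y) by ring.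
  have -> : - e * x + - e * m * y + e = e * (1 - x - m * y) by ring.
  rewrite -[in X in [/\ _, _, X & _]]subr_ge0.
  have -> : 1 - (c * ((1 - n) * x - (1 - m) * y) +
     (1 - w) * (e * (1 - x - m * y))) = c * ((1 - m * n) * y).
    by rewrite /c /e; field; rewrite !subr_eq0 ?gt_eqF.
  rewrite -[in X in [/\ _, _, _ & X]]subr_ge0.
  have -> : 1 - e * (1 - x - m * y) = e * (1 - w - (1 - x - m * y)).
    by rewrite /e; field; rewrite subr_eq0 gt_eqF.
  by rewrite !pmulr_rge0//; clear; split=> -[? ? ? ?]; split => //; lra.
have EE z : E z <-> [/\ (1 - n) * z 0 0 <= (1 - m) * z 0 1,
    0 <= 1 - n * z 0 0 - z 0 1, 0 <= z 0 0 & 1 - n * z 0 0 - z 0 1 <= 1 - w].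
  rewrite /E /trapezoid /quad /= !affE mul0r add0r.
  set x := z 0 0; set y := z 0 1.
  have -> : - d * (1 - n) * x + d * (1 - m) * y + 0 =
    d * ((1 - m) * y - (1 - n) * x) by ring.
  have -> : - e * n * x + - e * y + e = e * (1 - n * x - y) by ring.
  rewrite -[in X in [/\ _, _, X & _]]subr_ge0.
  have -> : 1 - (d * ((1 - m) * y - (1 - n) * x) +
     (1 - w) * (e * (1 - n * x - y))) = d * ((1 - m * n) * x).
    by rewrite /d /e; field; rewrite !subr_eq0 ?gt_eqF.
  rewrite -[in X in [/\ _, _, _ & X]]subr_ge0.
  have -> : 1 - e * (1 - n * x - y) = e * (1 - w - (1 - n * x - y)).
    by rewrite /e; field; rewrite subr_eq0 gt_eqF.
  by rewrite !pmulr_rge0//; clear; split=> -[? ? ? ?]; split => //; lra.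
rewrite -addnA -[q]addn0.
apply: (@tiled_cover _ _ _ [:: (1%N, K); (p, B); (q, E)]).
- rewrite !big_cons big_nil setU0; apply/seteqP; split=> z;
    rewrite /setU /mkset /= KE BE EE /quad /=; set x := z 0 0; set y := z 0 1.
    (* Comparing the two forms tells on which side of the diagonal the point lies. *)
    clear => -[? ? ? ?]; have [?|?] := leP (x + m * y) (n * x + y).
      have [?|?] := leP (n * x + y) w; first by left; split => //; lra.
      by right; right; split => //; lra.
    have [?|?] := leP (x + m * y) w; first by left; split => //; lra.
    by right; left; split => //; lra.
  clear -m1 n1 w0 w1.
  case=> [[? ? ? ?]|[[xy ? y0 ?]|[xy ? x0 ?]]]; split => //; try lra.
    by rewrite -(@pmulr_rge0 _ (1 - n)) ?subr_gt0// (le_trans _ xy)//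
      mulr_ge0// subr_ge0 ltW.
  by rewrite -(@pmulr_rge0 _ (1 - m)) ?subr_gt0// (le_trans _ xy)//
      mulr_ge0// subr_ge0 ltW.
- rewrite /= !andbT; apply/and3P; split; apply/asboolP.
  + by apply: aff_copy_quad; rewrite mulr0 subr0 mulf_eq0 !gt_eqF.
  + apply: tiled_aff => //.
    have -> : c * (1 - n) * (- e * m) - - c * (1 - m) * - e =
      - (c * e * (1 - m * n)) by ring.
    by rewrite oppr_eq0 !mulf_eq0 !gt_eqF.
  + apply: tiled_aff => //.
    have -> : - d * (1 - n) * - e - d * (1 - m) * (- e * n) =
      d * e * (1 - m * n) by ring.
    by rewrite !mulf_eq0 !gt_eqF.
- rewrite /= !andbT; apply/andP; split; [apply/andP; split|]; apply/asboolP.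
  + apply: (@separated_intro _ (-1) (- m) w).
      by rewrite oppr_eq0 oner_eq0.
      by move=> z /KE; clear => -[? ? ? ?]; lra.
    by move=> z /BE; clear => -[? ? ? ?]; lra.
  + apply: (@separated_intro _ (- n) (-1) w).
      by rewrite !oppr_eq0 oner_eq0 orbT.
      by move=> z /KE; clear => -[? ? ? ?]; lra.
    by move=> z /EE; clear => -[? ? ? ?]; lra.
  + apply: (@separated_intro _ (1 - n) (m - 1) 0).
    - by rewrite subr_eq0 gt_eqF.
    - by move=> z /BE; clear => -[? ? ? ?]; lra.
    - by move=> z /EE; clear => -[? ? ? ?]; lra.
Qed.

(* The expression is linear in (u, v); for s > 1 its minimum on the region is at
   u = v = eps, whence the multipliers below. *)
Lemma corner_ge0 (a b s eps u v : R) : 0 < a -> 0 < b -> 0 < s ->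
  s = a + b - 1 -> eps < 1 -> eps < s -> 0 <= u -> 0 <= v ->
  u + a * (v - u) <= eps -> v + b * (u - v) <= eps ->
  0 <= s + (1 - b) * u - a * v.
Proof.
move=> a0 b0 s0 sE eps1 epss u0 v0 h1 h2; have [sle|sgt] := leP s 1.
  (* Bounding [a * v] by the first constraint leaves [s - eps + (1 - s) * u]. *)
  have : 0 <= (1 - s) * u by rewrite mulr_ge0// subr_ge0.
  by nra.
rewrite -(@pmulr_rge0 _ s)//.
have -> : s * (s + (1 - b) * u - a * v) = s ^+ 2 * (1 - eps) +
   (a * b + (1 - b) ^+ 2) * (eps - (u + a * (v - u))) +
   a * (s - 1) * (eps - (v + b * (u - v))) by rewrite sE; ring.
by rewrite !addr_ge0// !mulr_ge0// ?sqr_ge0 ?subr_ge0 ?addr_ge0 ?sqr_ge0//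
  ?mulr_ge0 ?ltW.
Qed.

(* U and V vanish on the sides BA and EA. The four pieces K, A, B, E are named
   after the vertex they contain (K at C) and meet at the point U = V = eps;
   both trapezoids have sides proportional to s - eps and s * (1 - eps). *)
Lemma tiled_even m n w (a b s eps : R) p q :
  a = (1 - m) / (1 - m * n) -> b = (1 - n) / (1 - m * n) -> s = a + b - 1 ->
  m < 1 -> n < 1 -> m * n < 1 -> s != 1 -> 0 < eps < 1 -> eps < s ->
  s * (1 - eps) = w * (s - eps) ->
  tiled (quad m n) p (trapezoid w) -> tiled (quad m n) q (trapezoid w) ->
  tiled (quad m n) (2 + p + q) (quad m n).
Proof.
move=> aE bE sE m1 n1 mn1 s1 /andP[eps0 eps1] epss wE Dp Dq.
have mn0 : 0 < 1 - m * n by rewrite subr_gt0.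
have a0 : 0 < a by rewrite aE divr_gt0 ?subr_gt0.
have b0 : 0 < b by rewrite bE divr_gt0 ?subr_gt0.
have mnN0 : 1 - m * n != 0 by rewrite gt_eqF.
(* [(a, b)] is the vertex [A], where [x + m * y = 1] and [n * x + y = 1] meet. *)
have bmE : m * b = 1 - a by rewrite aE bE; field.
have anE : n * a = 1 - b by rewrite aE bE; field.
have asE : a * (1 - n) = s by lra.
have bsE : b * (1 - m) = s by lra.
have s0 : 0 < s by rewrite -asE mulr_gt0// subr_gt0.
have as1E : a * (1 - m) + s * m = 1 - m by rewrite sE aE bE; field.
have bs1E : b * (1 - n) + s * n = 1 - n by rewrite sE aE bE; field.
clear aE bE mnN0.
pose k : R := (1 - eps)^-1; pose e : R := eps^-1; pose d : R := (s - eps)^-1.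
have k0 : 0 < k by rewrite invr_gt0 subr_gt0.
have e0 : 0 < e by rewrite invr_gt0.
have d0 : 0 < d by rewrite invr_gt0 subr_gt0.
have eE : e * eps = 1 by rewrite mulVf// gt_eqF.
have dE : d * (s - eps) = 1 by rewrite mulVf// subr_eq0 gt_eqF.
have wdE : (1 - w) * e = d * (s - 1).
  apply: (@mulfI _ (s - eps)); first by rewrite subr_eq0 gt_eqF.
  apply: (@mulfI _ eps); first by rewrite gt_eqF.
  have -> : eps * ((s - eps) * ((1 - w) * e)) =
    (e * eps) * ((s - eps) - w * (s - eps)) by ring.
  have -> : eps * ((s - eps) * (d * (s - 1))) =
    (d * (s - eps)) * (eps * (s - 1)) by ring.
  by rewrite eE dE -wE; ring.
pose U (z : 'rV[R]_2) : R := 1 - z 0 0 - m * z 0 1.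
pose V (z : 'rV[R]_2) : R := 1 - n * z 0 0 - z 0 1.
pose K := aff k 0 0 0 k 0 @^-1` quad m n.
(* The copy has its [C] at the vertex [A], its sides [CB] and [CE] along [AB] and [AE], and its
   opposite vertex at [U = V = eps]. *)
pose A := aff (- (e * a * n)) (- (e * a)) (e * a)
              (- (e * b)) (- (e * b * m)) (e * b) @^-1` quad m n.
(* The parallel sides lie on [U = 0] and [U = eps], the legs on [y = 0] and on a side of the piece
   [A]; the piece [E] is symmetric. *)
pose B := aff (d * (s - 1)) (- d * (a * (1 - m) + m)) (d * (1 - eps))
              (- e) (- e * m) e @^-1` trapezoid w.
pose E := aff (- d * (b * (1 - n) + n)) (d * (s - 1)) (d * (1 - eps))
              (- e * n) (- e) e @^-1` trapezoid w.
have KE z : K z <-> [/\ 0 <= z 0 0, 0 <= z 0 1, eps <= U z & eps <= V z].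
  rewrite /K /quad /= !affE !mul0r !addr0 add0r !pmulr_rge0//.
  have -> : k * z 0 0 + m * (k * z 0 1) = k * (z 0 0 + m * z 0 1) by ring.
  have -> : n * (k * z 0 0) + k * z 0 1 = k * (n * z 0 0 + z 0 1) by ring.
  rewrite !ler_pdivrMl ?subr_gt0// mulr1 /U /V.
  by clear; split=> -[? ? ? ?]; split => //; lra.
have AE z : A z <-> [/\ 0 <= V z, 0 <= U z, U z + a * (V z - U z) <= eps
    & V z + b * (U z - V z) <= eps].
  rewrite /A /quad /= !affE.
  have -> : - (e * a * n) * z 0 0 + - (e * a) * z 0 1 + e * a = e * (a * V z).
    by rewrite /V; ring.
  have -> : - (e * b) * z 0 0 + - (e * b * m) * z 0 1 + e * b = e * (b * U z).
    by rewrite /U; ring.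
  have -> : e * (a * V z) + m * (e * (b * U z)) =
      e * (a * V z + (m * b) * U z) by ring.
  have -> : n * (e * (a * V z)) + e * (b * U z) =
      e * ((n * a) * V z + b * U z) by ring.
  rewrite !pmulr_rge0// !ler_pdivrMl// bmE anE mulr1.
  by clear; split=> -[? ? ? ?]; split => //; lra.
have BE z : B z <-> [/\ eps <= U z + a * (V z - U z), 0 <= U z, 0 <= z 0 1
    & U z <= eps].
  rewrite /B /trapezoid /quad /= !affE mul0r add0r.
  have -> : d * (s - 1) * z 0 0 + - d * (a * (1 - m) + m) * z 0 1 +
      d * (1 - eps) = d * (U z + a * (V z - U z) - eps).
    by rewrite /U /V -asE; ring.
  have -> : - e * z 0 0 + - e * m * z 0 1 + e = e * U z by rewrite /U; ring.
  rewrite -[in X in [/\ _, _, X & _]]subr_ge0.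
  have -> : 1 - (d * (U z + a * (V z - U z) - eps) + (1 - w) * (e * U z)) =
      d * ((1 - m) * z 0 1).
    by rewrite mulrA wdE -[X in X - _]dE -as1E /U /V -asE; ring.
  rewrite !pmulr_rge0 ?subr_gt0// ler_pdivrMl// mulr1 subr_ge0.
  by split=> -[? ? ? ?]; split.
have EE z : E z <-> [/\ eps <= V z + b * (U z - V z), 0 <= V z, 0 <= z 0 0
    & V z <= eps].
  rewrite /E /trapezoid /quad /= !affE mul0r add0r.
  have -> : - d * (b * (1 - n) + n) * z 0 0 + d * (s - 1) * z 0 1 +
      d * (1 - eps) = d * (V z + b * (U z - V z) - eps).
    by rewrite /U /V -bsE; ring.
  have -> : - e * n * z 0 0 + - e * z 0 1 + e = e * V z by rewrite /V; ring.
  rewrite -[in X in [/\ _, _, X & _]]subr_ge0.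
  have -> : 1 - (d * (V z + b * (U z - V z) - eps) + (1 - w) * (e * V z)) =
      d * ((1 - n) * z 0 0).
    by rewrite mulrA wdE -[X in X - _]dE -bs1E /U /V -bsE; ring.
  rewrite !pmulr_rge0 ?subr_gt0// ler_pdivrMl// mulr1 subr_ge0.
  by split=> -[? ? ? ?]; split.
have DE z : quad m n z <-> [/\ 0 <= z 0 0, 0 <= z 0 1, 0 <= U z & 0 <= V z].
  by rewrite /quad /U /V /=; clear; split=> -[? ? ? ?]; split => //; lra.
have UVE (z : 'rV[R]_2) : (1 - n) * z 0 0 = (1 - m) * z 0 1 + (V z - U z).
  by rewrite /U /V; ring.
rewrite -addnA -[q]addn0.
apply: (@tiled_cover _ _ _ [:: (1%N, K); (1%N, A); (p, B); (q, E)]).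
- rewrite !big_cons big_nil setU0; apply/seteqP; split=> z;
    rewrite /setU /mkset /= KE AE BE EE DE; have := UVE z.
    move: (U z) (V z) (z 0 0) (z 0 1) => u v x y uv [x0 y0 u0 v0].
    clear -sE s0 eps0 x0 y0 u0 v0.
    have [uv'|vu] := leP u v.
      have [ue|ue] := leP eps u; first by left; split => //; lra.
      have [ae|ae] := leP eps (u + a * (v - u)).
        by right; right; left; split => //; lra.
      right; left; split => //; first lra.
      (* The two bounds defining the piece [A] differ by [s * (v - u)], so here the first implies
         the second. *)
      have : 0 <= s * (v - u) by apply: mulr_ge0; lra.
      by rewrite sE; nra.
    have [ve|ve] := leP eps v; first by left; split => //; lra.
    have [be|be] := leP eps (v + b * (u - v)).
      by right; right; right; split => //; lra.
    right; left; split => //; last lra.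
    have : 0 <= s * (u - v) by apply: mulr_ge0; lra.
    by rewrite sE; nra.
  (* The coordinates are recovered from [U] and [V], so that [corner_ge0] can show that the piece
     [A] does not cross the axes. *)
  have y0E : a * ((1 - m * n) * z 0 1) = s + (1 - b) * U z - a * V z.
    by rewrite -anE -asE /U /V; ring.
  have x0E : b * ((1 - m * n) * z 0 0) = s + (1 - a) * V z - b * U z.
    by rewrite -bmE -bsE /U /V; ring.
  move: y0E x0E.
  move: (U z) (V z) (z 0 0) (z 0 1) => u v x y y0E x0E uv.
  clear -m1 n1 mn0 a0 b0 s0 sE eps0 eps1 epss y0E x0E uv.
  case=> [[? ? ? ?]|[[v0 u0 h1 h2]|[[h u0 y0 ue]|[h v0 x0 ve]]]].
  + by split => //; lra.
  + split => //.
      rewrite -(pmulr_rge0 _ mn0) -(pmulr_rge0 _ b0) x0E.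
      by apply: (@corner_ge0 b a s eps) => //; rewrite sE (addrC a).
    rewrite -(pmulr_rge0 _ mn0) -(pmulr_rge0 _ a0) y0E.
    exact: (@corner_ge0 a b s eps).
  + have vu : 0 <= v - u by rewrite -(pmulr_rge0 _ a0); lra.
    split => //; last by lra.
    rewrite -(@pmulr_rge0 _ (1 - n)) ?subr_gt0// uv addr_ge0// mulr_ge0//.
    by rewrite subr_ge0 ltW.
  + have vu : 0 <= u - v by rewrite -(pmulr_rge0 _ b0); lra.
    split => //; last by lra.
    have uv' : (1 - m) * y = (1 - n) * x + (u - v) by lra.
    rewrite -(@pmulr_rge0 _ (1 - m)) ?subr_gt0// uv' addr_ge0// mulr_ge0//.
    by rewrite subr_ge0 ltW.
- rewrite /= !andbT; apply/and4P; split; apply/asboolP.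
  + by apply: aff_copy_quad; rewrite mulr0 subr0 mulf_eq0 !gt_eqF.
  + apply: aff_copy_quad.
    have -> : - (e * a * n) * - (e * b * m) - - (e * a) * - (e * b) =
      - (e * e * a * b * (1 - m * n)) by ring.
    by rewrite oppr_eq0 !mulf_eq0 !gt_eqF.
  + apply: tiled_aff => //.
    have -> : d * (s - 1) * (- e * m) - - d * (a * (1 - m) + m) * - e =
      - (d * e * (1 - m)) by rewrite -[in RHS]as1E; ring.
    by rewrite oppr_eq0 !mulf_eq0 !gt_eqF// subr_gt0.
  + apply: tiled_aff => //.
    have -> : - d * (b * (1 - n) + n) * - e - d * (s - 1) * (- e * n) =
      d * e * (1 - n) by rewrite -[in RHS]bs1E; ring.
    by rewrite !mulf_eq0 !gt_eqF// subr_gt0.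
- rewrite /= !andbT; apply/and3P; split;
    [apply/and3P; split|apply/andP; split|];
    apply/asboolP.
  (* [K] and [A] are separated by the parallel to the diagonal [BE] through their common point
     [U = V = eps]. *)
  + apply: (@separated_intro _ (-1) (-1) ((a + b) * (1 - eps))).
    * by rewrite oppr_eq0 oner_eq0.
    * move=> z /KE[? ? ? ?].
      have -> : -1 * z 0 0 + -1 * z 0 1 + (a + b) * (1 - eps) =
          a * (V z - eps) + b * (U z - eps).
        have -> : a * (V z - eps) + b * (U z - eps) =
          - (n * a + b) * z 0 0 - (a + m * b) * z 0 1 + (a + b) * (1 - eps).
          by rewrite /U /V; ring.
        by rewrite anE bmE; ring.
      by rewrite addr_ge0// mulr_ge0 ?subr_ge0// ltW.
    * move=> z /AE[? ? h1 h2].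
      have -> : -1 * z 0 0 + -1 * z 0 1 + (a + b) * (1 - eps) =
          b * (U z + a * (V z - U z) - eps) + a * (V z + b * (U z - V z) - eps).
        have -> : b * (U z + a * (V z - U z) - eps) +
            a * (V z + b * (U z - V z) - eps) =
          - (n * a + b) * z 0 0 - (a + m * b) * z 0 1 + (a + b) * (1 - eps).
          by rewrite /U /V; ring.
        by rewrite anE bmE; ring.
      by rewrite -oppr_ge0 opprD addr_ge0// -mulrN
        mulr_ge0 ?oppr_ge0 ?subr_le0// ltW.
  + apply: (@separated_intro _ (-1) (- m) (1 - eps)).
    * by rewrite oppr_eq0 oner_eq0.
    * by move=> z /KE[_ _]; rewrite /U /V; clear => ? ?; lra.
    * by move=> z /BE[_ _ _]; rewrite /U; clear => ?; lra.
  + apply: (@separated_intro _ (- n) (-1) (1 - eps)).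
    * by rewrite !oppr_eq0 oner_eq0 orbT.
    * by move=> z /KE[_ _]; rewrite /U /V; clear => ? ?; lra.
    * by move=> z /EE[_ _ _]; rewrite /V; clear => ?; lra.
  + apply: (@separated_intro _ (1 - s) (a * (1 - m) + m) (eps - 1)).
    * by rewrite subr_eq0 eq_sym s1.
    * move=> z /AE[? ? h1 ?].
      have -> : (1 - s) * z 0 0 + (a * (1 - m) + m) * z 0 1 + (eps - 1) =
        eps - (U z + a * (V z - U z)) by rewrite -asE /U /V; ring.
      by rewrite subr_ge0.
    * move=> z /BE[h1 ? ? ?].
      have -> : (1 - s) * z 0 0 + (a * (1 - m) + m) * z 0 1 + (eps - 1) =
        eps - (U z + a * (V z - U z)) by rewrite -asE /U /V; ring.
      by rewrite subr_le0.
  + apply: (@separated_intro _ (b * (1 - n) + n) (1 - s) (eps - 1)).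
    * by rewrite orbC subr_eq0 eq_sym s1.
    * move=> z /AE[? ? ? h2].
      have -> : (b * (1 - n) + n) * z 0 0 + (1 - s) * z 0 1 + (eps - 1) =
        eps - (V z + b * (U z - V z)) by rewrite -bsE /U /V; ring.
      by rewrite subr_ge0.
    * move=> z /EE[h2 ? ? ?].
      have -> : (b * (1 - n) + n) * z 0 0 + (1 - s) * z 0 1 + (eps - 1) =
        eps - (V z + b * (U z - V z)) by rewrite -bsE /U /V; ring.
      by rewrite subr_le0.
  + apply: (@separated_intro _ (1 - n) (m - 1) 0).
    * by rewrite subr_eq0 gt_eqF.
    * move=> z /BE[h _ _ H].
      have : 0 <= a * (V z - U z) by clear -h H; lra.
      by rewrite pmulr_rge0// /U /V; clear; lra.
    * move=> z /EE[h _ _ H].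
      have : 0 <= b * (U z - V z) by clear -h H; lra.
      by rewrite pmulr_rge0// /U /V; clear; lra.
Qed.

End Dissections.

(** * Choice of the dissection for each number of pieces *)

Section SelfTilings.
Variable R : realType.
Implicit Types m n w : R.

Lemma tiled_transport (D D' : set 'rV[R]_2) k :
  affine_copy D D' -> tiled D k D -> tiled D' k D'.
Proof.
move=> [f invf ->] Dk; apply: (@tiled_base _ _ D); last exact: tiled_preimage.
have [g [invg fK gK]] := invertible_affine_inv invf.
exists g => //; apply/seteqP; split=> z /=; first by rewrite gK.
by rewrite gK.
Qed.

Lemma quad_swap m n : affine_copy (quad n m) (quad m n).
Proof.
exists (aff 0 1 0 1 0 0).
  by apply: aff_invertible; rewrite mulr0 mulr1 sub0r oppr_eq0 oner_eq0.
apply/seteqP; split=> z; rewrite /quad /= !affE => -[? ? ? ?]; split; lra.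
Qed.

(** The frame is moved to [B]: the vertices [B], [A], [E], [C] take the roles of [C], [B], [A], [E],
    which exchanges the diagonals. *)
Lemma quad_rotate m n : m < 1 -> n < 1 -> m * n < 1 ->
  affine_copy (quad (- n / (1 - n)) (m * (1 - n) / (1 - m * n))) (quad m n).
Proof.
move=> m1 n1 mn1; pose c : R := (1 - m * n) / (1 - n).
have c0 : 0 < c by rewrite divr_gt0 ?subr_gt0.
have d0 : 0 < 1 - n by rewrite subr_gt0.
have e0 : 0 < 1 - m * n by rewrite subr_gt0.
exists (aff 0 c 0 (-1) (- m) 1).
  by apply: aff_invertible; rewrite mul0r mulrN1 opprK add0r gt_eqF.
have E1 (x y : R) : c * y + - n / (1 - n) * (-1 * x + - m * y + 1) =
    1 - (1 - n)^-1 * (1 - (n * x + y)).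
  by rewrite /c; field; rewrite gt_eqF.
have E2 (x y : R) : m * (1 - n) / (1 - m * n) * (c * y) +
    (-1 * x + - m * y + 1) = 1 - x.
  by rewrite /c; field; rewrite !gt_eqF.
have inv0 : 0 < (1 - n)^-1 by rewrite invr_gt0.
apply/seteqP; split=> z;
  rewrite /quad /= !affE mul0r add0r !addr0 E1 E2 !gerBl !pmulr_rge0// subr_ge0;
  by move=> [? ? ? ?]; split => //; lra.
Qed.

(** A zero parameter means a pair of parallel sides, so slicing suffices. *)
Lemma quad_trapezoid_tiled m n k : m = 0 \/ n = 0 ->
  tiled (quad m n) k.+1 (quad m n).
Proof.
wlog -> : m n / n = 0 => [wl|_].
  case=> [m0|n0]; last by apply: wl => //; right.
  by apply: (tiled_transport (quad_swap m n)); apply: wl => //; right.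
have -> : quad m 0 = trapezoid (1 - m) by rewrite /trapezoid subKr.
rewrite -[k.+1]mul1n; apply: tiled_trapezoid; apply: affine_copy_tiled.
exists (aff 1 0 0 0 1 0).
  by apply: aff_invertible; rewrite mulr1 mulr0 subr0 oner_eq0.
apply/seteqP; split=> z; rewrite /trapezoid /quad /= !affE => -[? ? ? ?];
  by split; lra.
Qed.

(** The ratio from [quad_pair] equals 1 only if [m * (m + n - 2) = 0], which forces [m = 0];
    otherwise a flip makes it less than 1. *)
Lemma trapezoid_even_tiled m n : m < 1 -> n < 1 -> m * n < 1 -> m != 0 ->
  exists2 w : R, 0 < w < 1 & forall k,
    tiled (quad m n) (2 * k.+1) (trapezoid w) /\
    tiled (quad m n) (2 * k.+1) (trapezoid w^-1).
Proof.
move=> m1 n1 mn1 m0; have := quad_pair m1 n1 mn1.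
set w := _ / _ => Dw; have mn0 : 0 < 1 - m * n by rewrite subr_gt0.
have w0 : 0 < w by rewrite divr_gt0// exprn_gt0// subr_gt0.
have wN1 : w != 1.
  apply: contraNneq m0 => w1.
  have wE : w * (1 - m * n) = (1 - m) ^+ 2 by rewrite divfK// gt_eqF.
  rewrite w1 mul1r in wE.
  have /eqP : m * (m + n - 2) = 0 by lra.
  by rewrite mulf_eq0 => /orP[//|/eqP ?]; exfalso; lra.
have Dw' := trapezoid_flip w0 Dw.
have [w1|w1|we] := ltgtP w 1; last by rewrite we eqxx in wN1.
  by exists w; [rewrite w0|move=> k; split; exact: tiled_trapezoid].
exists w^-1; first by rewrite invr_gt0 w0 invf_lt1.
by move=> k; rewrite invrK; split; exact: tiled_trapezoid.
Qed.

(** [tiled_even] needs a ratio above 1 if [s < 1] and below 1 if [s > 1]; both [w] and [w^-1] are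
    available. *)
Lemma quad_even_tiled m n k : m < 1 -> n < 1 -> m * n < 1 -> m != 0 ->
  (1 - m) / (1 - m * n) + (1 - n) / (1 - m * n) - 1 != 1 ->
  tiled (quad m n) (2 + 2 + 2 * k.+1) (quad m n).
Proof.
move=> m1 n1 mn1 m0; set a := (1 - m) / _; set b := (1 - n) / _.
set s := a + b - 1 => s1.
have [w /andP[w0 w1] Dw] := trapezoid_even_tiled m1 n1 mn1 m0.
have mn0 : 0 < 1 - m * n by rewrite subr_gt0.
have s0 : 0 < s.
  have -> : s = (1 - m) * (1 - n) / (1 - m * n).
    by rewrite /s /a /b; field; rewrite gt_eqF.
  by rewrite divr_gt0// mulr_gt0 ?subr_gt0.
have even v : (v - s) * (s - 1) < 0 -> (v - 1) * (s - 1) < 0 -> 0 < v ->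
    (forall k, tiled (quad m n) (2 * k.+1) (trapezoid v)) ->
    tiled (quad m n) (2 + 2 + 2 * k.+1) (quad m n).
  move=> vs v1 v0 Dv; have vsN0 : v - s != 0.
    by apply: contraTneq vs => ->; rewrite mul0r ltxx.
  (* The solution of [s * (1 - eps) = v * (s - eps)]. *)
  pose eps : R := s * (v - 1) / (v - s).
  have epsE : eps * (v - s) = s * (v - 1) by rewrite /eps divfK.
  have [s1'|s1'|se] := ltgtP s 1; last by rewrite se eqxx in s1.
    have ? : 0 < v - s by nra.
    apply: (@tiled_even _ m n v a b s eps) => //; last exact: (Dv 0%N).
    - by rewrite divr_gt0//=; [rewrite ltr_pdivrMr//; nra|nra].
    - by rewrite ltr_pdivrMr//; nra.
    - by lra.
  have ? : 0 < s - v by nra.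
  have epsE' : eps = s * (1 - v) / (s - v).
    by rewrite /eps -[v - s]opprB -[v - 1]opprB mulrN invrN mulrNN.
  apply: (@tiled_even _ m n v a b s eps) => //; last exact: (Dv 0%N).
  - by rewrite epsE' divr_gt0//=; [rewrite ltr_pdivrMr//; nra|nra].
  - by rewrite epsE' ltr_pdivrMr//; nra.
  - by lra.
have [s1'|s1'|se] := ltgtP s 1; last by rewrite se eqxx in s1.
  have w'1 : 1 < w^-1 by rewrite invf_gt1.
  apply: (even w^-1); [nra|nra|by rewrite invr_gt0|].
  by move=> j; case: (Dw j).
by apply: (even w); [nra|nra|by []|move=> j; case: (Dw j)].
Qed.

Lemma quad_tiled m n k : m < 1 -> n < 1 -> m * n < 1 -> (5 <= k)%N ->
  tiled (quad m n) k (quad m n).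
Proof.
move=> m1 n1 mn1 k5.
have [m0|m0] := eqVneq m 0.
  by case: k k5 => // k _; apply: quad_trapezoid_tiled; left.
have [n0|n0] := eqVneq n 0.
  by case: k k5 => // k _; apply: quad_trapezoid_tiled; right.
have mn0 : 0 < 1 - m * n by rewrite subr_gt0.
have n0' : 0 < 1 - n by rewrite subr_gt0.
have := odd_double_half k; case: (odd k) => /= kE.
  have [w w01 Dw] := trapezoid_even_tiled m1 n1 mn1 m0.
  (* One copy, one trapezoid in two pieces, the other in the remaining [k - 3], an even number at
     least two. *)
  have -> : k = (1 + 2 * 1 + 2 * (k./2 - 2).+1)%N by lia.
  by apply: (tiled_odd m1 n1 mn1 w01); [case: (Dw 0%N)|
    case: (Dw (k./2 - 2)%N)].
have -> : k = (2 + 2 + 2 * (k./2 - 3).+1)%N by lia.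
(* Equality means that [BE] bisects [AC]; the other diagonal is then used. *)
have [s1|s1] := eqVneq ((1 - m) / (1 - m * n) + (1 - n) / (1 - m * n) - 1) 1;
  last exact: quad_even_tiled.
apply: (tiled_transport (quad_rotate m1 n1 mn1)).
have m'1 : - n / (1 - n) < 1 by rewrite ltr_pdivrMr//; lra.
have n'1 : m * (1 - n) / (1 - m * n) < 1 by rewrite ltr_pdivrMr//; lra.
have mnE : 1 - - n / (1 - n) * (m * (1 - n) / (1 - m * n)) = (1 - m * n)^-1.
  by field; rewrite !gt_eqF.
apply: quad_even_tiled => //.
- by rewrite -subr_gt0 mnE invr_gt0.
- by rewrite mulf_neq0 ?oppr_eq0// invr_neq0// gt_eqF.
rewrite mnE.
have e1 : 2 - m - n = 2 * (1 - m * n).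
  move: s1 => /(congr1 (fun t => (t + 1) * (1 - m * n))).
  by rewrite subrK -mulrDl divfK ?gt_eqF// => h; lra.
have -> : (1 - - n / (1 - n)) / (1 - m * n)^-1 +
    (1 - m * (1 - n) / (1 - m * n)) / (1 - m * n)^-1 - 1 =
    (1 - m * n) / (1 - n) - m.
  by field; rewrite !gt_eqF.
(* If both diagonals were bisected, then [m = n] and [m * (1 - m) = 0], against [m != 0] and
   [m < 1]. *)
apply: contraNneq m0 => h; have : (1 - m * n) = (1 + m) * (1 - n).
  have <- : (1 - m * n) / (1 - n) = 1 + m by lra.
  by rewrite divfK ?gt_eqF.
move=> h'; have mn : m = n by lra.
have /eqP : m * (1 - m) = 0 by rewrite -mn in e1; lra.
by rewrite mulf_eq0 => /orP[//|/eqP ?]; exfalso; lra.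
Qed.

End SelfTilings.

(** * Reduction to the normal form *)

Section NormalForm.
Variable R : realType.
Implicit Types (C : set 'rV[R]_2) (v : 'I_4 -> 'rV[R]_2) (c : 'I_4 -> R).

Lemma convex_set_comb C x y (t : R) :
  convex_set C -> 0 <= t <= 1 -> C x -> C y -> C (t *: x + (1 - t) *: y).
Proof.
move=> cC /andP[t0 t1] Cx Cy.
have /set_mem := cC x y (Itv01 t0 t1) (mem_set Cx) (mem_set Cy).
by [].
Qed.

Lemma convex_hull_sum (I : finType) (P : pred I) (A : set 'rV[R]_2)
    (v : I -> 'rV[R]_2) (c : I -> R) (i0 : I) :
  P i0 -> (forall j, P j -> A (v j)) -> (forall j, P j -> 0 <= c j) ->
  \sum_(j | P j) c j = 1 -> convex_hull A (\sum_(j | P j) c j *: v j).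
Proof.
move=> Pi0 Av c0 c1 C [cC AC].
(* Partial sums have weight [s] rather than 1, so the invariant is to be [s] times a point of [C];
   [i0] supplies that point for the empty sum. *)
pose Q (s : R) (u : 'rV[R]_2) := 0 <= s /\ exists2 x, C x & u = s *: x.
suff : Q (\sum_(j | P j) c j) (\sum_(j | P j) c j *: v j).
  by move=> [_ [x Cx ->]]; rewrite c1 scale1r.
elim/big_ind2 : _.
- split=> //; exists (v i0); last by rewrite scale0r.
  exact/AC/Av.
- move=> ? s ? t [s0 [x Cx ->]] [t0 [y Cy ->]]; split; first exact: addr_ge0.
  have [st0|st0] := eqVneq (s + t) 0.
    have /andP[/eqP -> /eqP ->] : (s == 0) && (t == 0).
      by rewrite -(paddr_eq0 s0 t0) st0.
    by exists x => //; rewrite !addr0 !scale0r addr0.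
  have st : 0 < s + t by rewrite lt0r st0 addr_ge0.
  exists (s / (s + t) *: x + (1 - s / (s + t)) *: y).
    apply: convex_set_comb => //; rewrite divr_ge0 ?(ltW st)//=.
    by rewrite ler_pdivrMr// mul1r lerDl.
  rewrite scalerDr !scalerA; by congr (_ *: _ + _ *: _); field.
- move=> j Pj; split; first exact: c0.
  by exists (v j) => //; exact/AC/Av.
Qed.

Lemma ord4_uniq (i j k l : 'I_4) : uniq [:: i; j; k; l] ->
  forall x, x \in [:: i; j; k; l].
Proof.
move=> uijkl x.
have [||_ ->] := uniq_min_size uijkl (_ : {subset _ <= enum 'I_4}).
- by move=> y; rewrite mem_enum.
- by rewrite size_enum_ord.
- by rewrite mem_enum.
Qed.

Lemma sum_ord4 (V : nmodType) (F : 'I_4 -> V) (i j k l : 'I_4) :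
  uniq [:: i; j; k; l] -> \sum_x F x = F i + F j + F k + F l.
Proof.
move=> uijkl; rewrite (perm_big [:: i; j; k; l]).
  by rewrite !big_cons big_nil /= addr0 !addrA.
apply: uniq_perm => //; first exact: index_enum_uniq.
by move=> x; rewrite mem_index_enum ord4_uniq.
Qed.

Lemma fun_ord4 (i j k l : 'I_4) (p q r s : R) : uniq [:: i; j; k; l] ->
  exists c, [/\ c i = p, c j = q, c k = r & c l = s].
Proof.
rewrite /= !inE !negb_or => /and4P[/and3P[ij ik il] /andP[jk jl] kl _].
exists (fun x => if x == i then p else if x == j then q
                 else if x == k then r else s).
by rewrite !eqxx (eq_sym j i) (eq_sym k i) (eq_sym l i) (eq_sym k j)
  (eq_sym l j) (eq_sym l k) (negbTE ij)
  (negbTE ik) (negbTE il) (negbTE jk) (negbTE jl) (negbTE kl).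
Qed.

Lemma convex_hull_ord4 v (i j k l : 'I_4) (p q r s : R) :
  uniq [:: i; j; k; l] -> 0 <= p -> 0 <= q -> 0 <= r -> 0 <= s ->
  p + q + r + s = 1 ->
  convex_hull (range v) (p *: v i + q *: v j + r *: v k + s *: v l).
Proof.
move=> uijkl p0 q0 r0 s0 pqrs.
have [c [ci cj ck cl]] := fun_ord4 p q r s uijkl.
rewrite -{}ci in p0 pqrs *; rewrite -{}cj in q0 pqrs *.
rewrite -{}ck in r0 pqrs *; rewrite -{}cl in s0 pqrs *.
rewrite -(sum_ord4 (fun x => c x *: v x) uijkl).
apply: (@convex_hull_sum _ xpredT _ v c i) => // [x _|].
- by have := ord4_uniq uijkl x; rewrite !inE => /or4P[] /eqP ->.
- by rewrite (sum_ord4 _ uijkl).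
Qed.

Definition affine_relation v c := \sum_j c j = 0 /\ \sum_j c j *: v j = 0.

Definition convex_position v :=
  forall i, ~ convex_hull (v @` [set j | j != i]) (v i).

(** Four rows with three entries are dependent; the constant third entry makes the coefficients sum
    to zero. *)
Lemma affine_relation_exists v :
  exists2 c, affine_relation v c & exists i, c i != 0.
Proof.
pose M : 'M[R]_(4, 2 + 1) := row_mx (\matrix_i v i) (const_mx 1).
have : kermx M != 0.
  by rewrite kermx_eq0 /row_free neq_ltn ltnS rank_leq_col.
move=> /rowV0Pn[u /sub_kermxP].
rewrite mul_mx_row -row_mx0 => /eq_row_mx[u0 u1] uN0.
exists (fun j => u 0 j); last first.
  apply/existsP; apply: contraNT uN0 => /existsPn u00; apply/eqP/rowP => i.
  by rewrite mxE; have /negPn/eqP := u00 i.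
split.
  move: u1 => /rowP/(_ 0); rewrite !mxE => u1; rewrite -[RHS]u1.
  by apply: eq_bigr => j _; rewrite mxE mulr1.
rewrite -[RHS]u0 mulmx_sum_row; apply: eq_bigr => j _.
by rewrite rowK.
Qed.

(** Were [c i] the only positive coefficient, solving for [v i] would make it a convex combination
    of the other points. *)
Lemma affine_relation_pos v c i : convex_position v -> affine_relation v c ->
  0 < c i -> exists2 j, j != i & 0 < c j.
Proof.
move=> cv [c0 cv0] ci; apply: contrapT => npos.
have npos' j : j != i -> c j <= 0.
  by move=> ji; rewrite leNgt; apply/negP => cj; apply: npos; exists j.
apply: (cv i); rewrite [X in convex_hull _ X](_ : _ =
    \sum_(j | j != i) (- c j / c i) *: v j); last first.
  move: cv0; rewrite (bigD1 i)//= => /eqP; rewrite addr_eq0 => /eqP cvE.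
  rewrite -[LHS](scalerK (lt0r_neq0 ci)) cvE scalerN -scaleNr scaler_sumr.
  by apply: eq_bigr => j _; rewrite scalerA mulNr mulrC mulNr.
have [j ji] : exists j : 'I_4, j != i.
  have [->|i0] := eqVneq i 0; first by exists 1.
  by exists 0; rewrite eq_sym.
apply: (@convex_hull_sum _ (fun k => k != i) _ v _ j ji).
- by move=> k ki; exists k.
- by move=> k ki; rewrite divr_ge0 ?oppr_ge0 ?npos'// ltW.
- move: c0; rewrite (bigD1 i)//= => /eqP; rewrite addrC addr_eq0 => /eqP cE.
  by rewrite -mulr_suml sumrN cE opprK divff// gt_eqF.
Qed.

(** Applying [affine_relation_pos] to [c] and to [- c] gives two coefficients of each sign; equal
    signs mark opposite vertices (Radon partition). *)
Lemma affine_relation_signs v c : convex_position v -> affine_relation v c ->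
  (exists i, c i != 0) -> exists i j k l, [/\ uniq [:: i; j; k; l],
    0 < c i, 0 < c j, c k < 0 & c l < 0].
Proof.
move=> cv rc [x cx].
have rNc : affine_relation v (fun j => - c j).
  have [c0 cv0] := rc; split; first by rewrite sumrN c0 oppr0.
  by under eq_bigr do rewrite scaleNr; rewrite sumrN cv0 oppr0.
have pos d : affine_relation v d -> d x != 0 -> exists i, 0 < d i.
  move=> [d0 _] dx; apply: contrapT => npos.
  have dle j : d j <= 0.
    by rewrite leNgt; apply/negP => dj; apply: npos; exists j.
  move: dx; suff /eqP : - d x = 0 by rewrite oppr_eq0 => ->.
  apply: (@psumr_eq0P R _ xpredT (fun j => - d j)) => // [j _|].
    by rewrite oppr_ge0.
  by rewrite sumrN d0 oppr0.
have [i ci] := pos _ rc cx.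
have [j ji cj] := affine_relation_pos cv rc ci.
have [k ck'] : exists k, 0 < - c k by apply: (pos _ rNc); rewrite oppr_eq0.
have [l lk] := affine_relation_pos cv rNc ck'.
rewrite oppr_gt0 => cl; have ck : c k < 0 by rewrite -oppr_gt0.
exists i, j, k, l; split => //=.
have ne a b : 0 < c a -> c b < 0 -> a != b.
  by move=> ca cb; apply: contraTneq ca => ->; rewrite -leNgt ltW.
rewrite !inE !negb_or (ne i k)// (ne i l)// (ne j k)// (ne j l)//.
by rewrite eq_sym ji eq_sym lk.
Qed.

Lemma affine_relation_neq0 v c : convex_position v -> affine_relation v c ->
  (exists i, c i != 0) -> forall i, c i != 0.
Proof.
move=> cv rc cN0 x.
have [i [j [k [l [uijkl ci cj ck cl]]]]] := affine_relation_signs cv rc cN0.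
(* If [c x] were zero, this indicator of [x] would vanish at [i], [j], [k], [l], hence everywhere,
   yet it sums to 1. *)
pose d (y : 'I_4) : R := (y == x)%:R.
have [e|] := eqVneq (c x) 0; last by [].
have := sum_ord4 d uijkl.
have d0 y : c y != 0 -> d y = 0.
  by rewrite /d; have [->|] := eqVneq y x; rewrite ?e ?eqxx.
rewrite !d0 ?(gt_eqF ci) ?(gt_eqF cj) ?(lt_eqF ck) ?(lt_eqF cl)//.
rewrite (bigD1 x)//= /d eqxx big1 => [|y /negbTE->//].
by rewrite !addr0 => /eqP; rewrite oner_eq0.
Qed.

(** A dependency between the edges at [v j] is an affine relation with coefficient zero at [i],
    hence trivial. *)
Lemma frame_independent v i j k l : convex_position v ->
  uniq [:: i; j; k; l] ->
  (v k - v j) 0 0 * (v l - v j) 0 1 - (v k - v j) 0 1 * (v l - v j) 0 0 != 0.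
Proof.
move=> cv uijkl; apply/eqP => det0.
have rel (p q : R) : p *: (v k - v j) + q *: (v l - v j) = 0 -> p = 0 /\ q = 0.
  move=> pq0.
  have [c [ci cj ck cl]] := fun_ord4 0 (- p - q) p q uijkl.
  have rc : affine_relation v c.
    split; rewrite (sum_ord4 _ uijkl) ci cj ck cl; first by ring.
    rewrite -[RHS]pq0 scale0r add0r; apply/rowP => x; rewrite !mxE; ring.
  have N0 x : c x = 0.
    apply/eqP/negPn/negP => cx.
    have := affine_relation_neq0 cv rc (ex_intro _ x cx) i.
    by rewrite ci eqxx.
  by rewrite -ck -cl !N0.
move: (v k - v j) (v l - v j) det0 rel => u w det0 rel.
(* With zero determinant, equal coordinates of [w] and [- u] form a dependency; so [w = 0], which is
   itself dependent. *)
have [w0 _] : w 0 0 = 0 /\ - u 0 0 = 0.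
  apply: rel; apply: row2P; rewrite !mxE; first by ring.
  by rewrite -[RHS]oppr0 -det0; ring.
have [w1 _] : w 0 1 = 0 /\ - u 0 1 = 0.
  apply: rel; apply: row2P; rewrite !mxE; last by ring.
  by rewrite -[RHS]det0; ring.
have [_ /eqP] : (0 : R) = 0 /\ (1 : R) = 0.
  by apply: rel; apply: row2P; rewrite scale0r add0r scale1r ?w0 ?w1 mxE.
by rewrite oner_eq0.
Qed.

Lemma convex_quadrangle_quad D : convex_quadrangle D ->
  exists m n : R, [/\ m < 1, n < 1, m * n < 1 & affine_copy (quad m n) D].
Proof.
move=> [v [cv ->]].
have [c rc cN0] := affine_relation_exists v.
have [i [j [k [l [uijkl ci cj ck cl]]]]] := affine_relation_signs cv rc cN0.
have det0 := frame_independent cv uijkl.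
have [c0 cv0] := rc; rewrite (sum_ord4 _ uijkl) in c0.
rewrite (sum_ord4 _ uijkl) in cv0.
(* The coordinates of [v i] in the frame at the opposite vertex [v j] with edges to [v k] and [v l];
   [1 < a + b] comes from [0 < c j]. *)
pose a : R := - c k / c i; pose b : R := - c l / c i.
have ciN0 : c i != 0 by rewrite gt_eqF.
have a0 : 0 < a by rewrite divr_gt0// oppr_gt0.
have b0 : 0 < b by rewrite divr_gt0// oppr_gt0.
have ab1 : 1 < a + b by rewrite -mulrDl ltr_pdivlMr//; lra.
have viE x : v i 0 x = v j 0 x + a * (v k - v j) 0 x + b * (v l - v j) 0 x.
  apply: (mulfI ciN0); move: cv0 => /rowP/(_ x); rewrite !mxE => cvx.
  have cjE : c j = - c i - c k - c l by lra.
  rewrite cjE in cvx.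
  have -> : c i * (v j 0 x + a * (v k 0 x - v j 0 x) + b * (v l 0 x - v j 0 x)) =
     c i * v j 0 x - c k * (v k 0 x - v j 0 x) - c l * (v l 0 x - v j 0 x).
    by rewrite /a /b; field.
  by lra.
pose m : R := (1 - a) / b; pose n : R := (1 - b) / a.
have mE : m * b = 1 - a by rewrite divfK// gt_eqF.
have nE : n * a = 1 - b by rewrite divfK// gt_eqF.
exists m, n.
have m1 : m < 1 by rewrite ltr_pdivrMr//; lra.
have n1 : n < 1 by rewrite ltr_pdivrMr//; lra.
split => //.
  rewrite -subr_gt0 -(pmulr_rgt0 _ (mulr_gt0 a0 b0)).
  have -> : a * b * (1 - m * n) = a * b - (m * b) * (n * a) by ring.
  by rewrite mE nE; lra.
pose g := aff ((v k - v j) 0 0) ((v l - v j) 0 0) (v j 0 0)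
              ((v k - v j) 0 1) ((v l - v j) 0 1) (v j 0 1).
have invg : invertible_affine g.
  by apply: aff_invertible; rewrite (mulrC ((v l - v j) 0 0)).
have [f [invf gK fK]] := invertible_affine_inv invg.
pose pt x y := aff 0 0 x 0 0 y (0 : 'rV[R]_2).
have vjE : v j = g (pt 0 0) by apply: row2P; rewrite /g /pt !affE; ring.
have vkE : v k = g (pt 1 0).
  by apply: row2P; rewrite /g /pt !affE !mxE; ring.
have vlE : v l = g (pt 0 1).
  by apply: row2P; rewrite /g /pt !affE !mxE; ring.
have viE' : v i = g (pt a b).
  by apply: row2P; rewrite /g /pt !affE viE; ring.
have quadpt x y : 0 <= x -> 0 <= y -> x + m * y <= 1 -> n * x + y <= 1 ->
    quad m n (pt x y).
  by move=> *; rewrite /quad /= /pt !affE !mul0r !add0r; split.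
exists f => //; apply/seteqP; split.
  apply: smallest_sub.
    move=> z z' t /set_mem Dz /set_mem Dz'; apply/mem_set.
    have t0 : 0 <= t%:num by [].
    have t1 : t%:num <= 1 by [].
    have [A [d [_ fE]]] := invf.
    have fconv : f (t%:num *: z + (1 - t%:num) *: z') =
        t%:num *: f z + (1 - t%:num) *: f z'.
      rewrite !fE mulmxDl -!scalemxAl !scalerDr addrACA; congr (_ + _).
      by rewrite -scalerDl addrC subrK scale1r.
    move: Dz Dz'; rewrite /preimage /= => Dz Dz'.
    suff : quad m n (f (t%:num *: z + (1 - t%:num) *: z')) by [].
    rewrite {}fconv; move: (f z) (f z') Dz Dz' => {}z {}z'.
    move: (t%:num) t0 t1 => {}t t0 t1; rewrite /quad /= !mxE.
    by move=> [? ? ? ?] [? ? ? ?]; split; nra.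
  move=> _ [x _ <-]; have := ord4_uniq uijkl x.
  rewrite !inE => /or4P[] /eqP -> /=; rewrite ?vjE ?vkE ?vlE ?viE' gK;
    by apply: quadpt; lra.
move=> z /= Kfz; rewrite -(fK z); move: (f z) Kfz => {}z [z0 z1 mz nz].
(* The diagonal from [v j] to [v i] cuts the region into two triangles, so one of the four weights
   is zero. *)
have [ayx|ayx] := leP (a * (z 0 1 / b)) (z 0 0).
  have -> : g z = (z 0 1 / b) *: v i + (1 - z 0 0 - m * z 0 1) *: v j +
      (z 0 0 - a * (z 0 1 / b)) *: v k + 0 *: v l.
    by apply: row2P; rewrite /g !affE !mxE viE !mxE /m; field; rewrite gt_eqF.
  apply: convex_hull_ord4 => //; last by rewrite /m; field; rewrite gt_eqF.
  - by rewrite divr_ge0// ltW.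
  - by lra.
  - by rewrite subr_ge0.
have -> : g z = (z 0 0 / a) *: v i + (1 - n * z 0 0 - z 0 1) *: v j +
    0 *: v k + (z 0 1 - b * (z 0 0 / a)) *: v l.
  by apply: row2P; rewrite /g !affE !mxE viE !mxE /n; field; rewrite gt_eqF.
apply: convex_hull_ord4 => //; last by rewrite /n; field; rewrite gt_eqF.
- by rewrite divr_ge0// ltW.
- by lra.
- rewrite subr_ge0 -(ler_pM2l a0).
  have -> : a * (b * (z 0 0 / a)) = b * z 0 0 by field; rewrite gt_eqF.
  have <- : b * (a * (z 0 1 / b)) = a * z 0 1 by field; rewrite gt_eqF.
  by rewrite ler_pM2l// ltW.
Qed.

End NormalForm.

Theorem theorem2 (R : realType) (D : set 'rV[R]_2) (n : nat)
  (hD : convex_quadrangle D) (hn : (5 <= n)%N) : self_affine n D.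
Proof.
have [m [m' [m1 m'1 mm'1 [f invf DE]]]] := convex_quadrangle_quad hD.
apply: tiled_self_affine.
  move=> _ [g invg ->]; rewrite DE.
  apply: (@closed_quad_preimage _ _ _ (f \o g)).
  exact: invertible_affine_comp.
by apply: (@tiled_transport _ (quad m m')); [exists f|exact: quad_tiled].
Qed.
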